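(* Let $\mathsf H=(\mathsf V,\mathsf E)$ be a directed hypergraph with Laplacian $\mathcal L$. Then the following assertions hold. (1) Each eigenvalue $\lambda$ of $\mathcal L$ satisfies $$\deg_{\min}(\mathsf V)-\max_{v\in\mathsf V}\sum_{\substack{w\in\mathsf V\\ w\ne v}}\bigl|\#\mathsf E^{\parallel}_{vw}-\#\mathsf E^{\nparallel}_{vw}\bigr|\le\lambda\le\deg_{\max}(\mathsf V)+\max_{v\in\mathsf V}\sum_{\substack{w\in\mathsf V\\ w\ne v}}\bigl|\#\mathsf E^{\parallel}_{vw}-\#\mathsf E^{\nparallel}_{vw}\bigr|$$ as well as $$\lambda\le\deg_{\max}(\mathsf E)+\max_{e\in\mathsf E}\sum_{\substack{f\in\mathsf E\\ f\ne e}}\Bigl|\#(e_{\rm targ}\cap f_{\rm targ})+\#(e_{\rm sour}\cap f_{\rm sour})-\#(e_{\rm targ}\cap f_{\rm sour})-\#(e_{\rm sour}\cap f_{\rm targ})\Bigr|.$$ In particular, if for each $v\in\mathsf V$ $$\deg(v)>\sum_{\substack{w\in\mathsf V\\ w\ne v}}\bigl|\#\mathsf E^{\parallel}_{vw}-\#\mathsf E^{\nparallel}_{vw}\bigr|,$$ then $0$ is not an eigenvalue of $\mathcal L$ and $(\mathrm e^{-t\mathcal L})_{t\ge0}$ is exponentially stable. (2) Each eigenvalue $\lambda$ of $\mathcal L$ satisfies $$2\deg_{\min}(\mathsf V)-\max_{v\in\mathsf V}\sum_{e\in\mathsf E_v}\deg(e)\le\lambda\le\max_{v\in\mathsf V}\sum_{e\in\mathsf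 E_v}\deg(e)$$ as well as $$\lambda\le\max_{e\in\mathsf E}\sum_{v\in e}\deg(v).$$ In particular, if for each $v\in\mathsf V$ $$2\deg(v)>\sum_{e\in\mathsf E_v}\deg(e),$$ then $0$ is not an eigenvalue of $\mathcal L$ and $(\mathrm e^{-t\mathcal L})_{t\ge0}$ is exponentially stable.
   Context: A directed hypergraph $\mathsf H=(\mathsf V,\mathsf E)$ consists of a finite set $\mathsf V$ (vertices) and a finite multiset $\mathsf E$ of hyperedges $e=(e_{\rm sour},e_{\rm targ})$, where $e_{\rm sour},e_{\rm targ}\subset\mathsf V$ are disjoint (possibly empty) sets; $v\in e$ means $v\in e_{\rm sour}\cup e_{\rm targ}$. Sums over $\mathsf E$ count multiplicity, i.e. $f\neq e$ means distinct elements of the multiset. $\mathsf V$ and $\mathsf E$ are nonempty so that the maxima make sense. The incidence matrix is the $\mathsf V\times\mathsf E$-matrix $\mathcal I=(\iota_{ve})$ with $\iota_{ve}=+1$ if $v\in e_{\rm targ}$, $\iota_{ve}=-1$ if $v\in e_{\rm sour}$, $\iota_{ve}=0$ otherwise; the Laplacian is $\mathcal L:=\mathcal I\mathcal I^\top$. Two vertices $v,w$ are co-oriented (resp. anti-oriented) in $e$ if $\iota_{ve}\iota_{we}=+1$ (resp. $-1$). $\mathsf E_v$ is the set of hyperedges containing $v$; $\mathsf E^{\parallel}_{vw}$ (resp. $\mathsf E^{\nparallel}_{vw}$) is the set of hyperedges in which $v,w$ are co-oriented (resp. anti-oriented). $\#S$ is the cardinality of $S$ (with multiplicity). $\deg(v)=\#\mathsf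 E_v$, $\deg_{\min}(\mathsf V)=\min_v\deg(v)$, $\deg_{\max}(\mathsf V)=\max_v\deg(v)$, $\deg(e)=\#e_{\rm sour}+\#e_{\rm targ}$, $\deg_{\max}(\mathsf E)=\max_e\deg(e)$. Exponentially stable means that there are $M\ge1,\omega>0$ with $\|\mathrm e^{-t\mathcal L}\|\le M\mathrm e^{-\omega t}$ for all $t\ge0$. *)

(* Defs.v *)
From HB Require Import structures.
From mathcomp Require Import all_boot all_order all_algebra.
From mathcomp Require Import complex.
From mathcomp Require Import all_classical all_reals all_analysis.

Set Implicit Arguments.
Unset Strict Implicit.
Unset Printing Implicit Defensive.

Import Order.TTheory GRing.Theory Num.Theory.
Import numFieldNormedType.Exports.

Local Open Scope ring_scope.

(* The multiset of hyperedges is a family indexed by a finite type E: equal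
   (source, target) pairs at different indices are distinct hyperedges, so that
   sums over E count multiplicity. *)
Record dihypergraph (V E : finType) := DiHypergraph {
  sour : E -> {set V};
  targ : E -> {set V};
  sour_targ_disjoint : forall e, [disjoint sour e & targ e]
}.

Section Hypergraph.
Variables (V E : finType) (H : dihypergraph V E).

Definition support (e : E) : {set V} := sour H e :|: targ H e.

Definition iota_ve (v : V) (e : E) : int :=
  if v \in targ H e then 1 else if v \in sour H e then -1 else 0.

Definition edges_at (v : V) : {set E} := [set e | v \in support e].

Definition co_edges (v w : V) : {set E} :=
  [set e | iota_ve v e * iota_ve w e == 1].

Definition anti_edges (v w : V) : {set E} :=
  [set e | iota_ve v e * iota_ve w e == -1].

Definition vdeg (v : V) : nat := #|edges_at v|.

Definition edeg (e : E) : nat := (#|sour H e| + #|targ H e|)%N.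

(* Every degree is at most #|E|, hence the neutral value #|E| does not affect
   the minimum when V is nonempty. *)
Definition vdeg_min : nat := \big[minn/#|E|]_(v : V) vdeg v.

Definition vdeg_max : nat := \max_(v : V) vdeg v.

Definition edeg_max : nat := \max_(e : E) edeg e.

(* In the next two definitions the subtraction is that of int, and absz is the
   absolute value with values in nat. *)
Definition orient_sum (v : V) : nat :=
  (\sum_(w : V | w != v) absz ((#|co_edges v w|)%:Z - (#|anti_edges v w|)%:Z)%R)%N.

Definition overlap_sum (e : E) : nat :=
  (\sum_(f : E | f != e)
    absz ((#|targ H e :&: targ H f|)%:Z + (#|sour H e :&: sour H f|)%:Z
          - (#|targ H e :&: sour H f|)%:Z - (#|sour H e :&: targ H f|)%:Z)%R)%N.

Definition edeg_sum (v : V) : nat := (\sum_(e in edges_at v) edeg e)%N.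

Definition vdeg_sum (e : E) : nat := (\sum_(v in support e) vdeg v)%N.

(* Vertices and hyperedges are numbered by the canonical enumerations of V and
   E; K is the ring in which the integer entries are read. *)
Definition incidence (K : pzRingType) : 'M[K]_(#|V|, #|E|) :=
  \matrix_(i, j) (iota_ve (enum_val i) (enum_val j))%:~R.

Definition laplacian (K : pzRingType) : 'M[K]_#|V| :=
  incidence K *m (incidence K)^T.

End Hypergraph.

Section Semigroup.
Variables (R : realType) (n : nat).

Definition expmx (A : 'M[R]_n) : 'M[R]_n :=
  limn (fun N => \sum_(0 <= k < N) (k`!%:R)^-1 *: A ^+ k).

Definition l2norm (x : 'cV[R]_n) : R := Num.sqrt (\sum_i x i 0 ^+ 2).

(* The operator norm induced by the Euclidean norm; the norm `|A| which the
   library puts on matrices is the largest absolute value of an entry. *)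
Definition l2opnorm (A : 'M[R]_n) : R :=
  sup [set l2norm (A *m x) | x in [set x | l2norm x <= 1]]%classic.

Definition exponentially_stable (S : R -> 'M[R]_n) : Prop :=
  exists M omega : R, [/\ 1 <= M, 0 < omega &
    forall t, 0 <= t -> l2opnorm (S t) <= M * expR (- omega * t)].

End Semigroup.

(* Main.v *)
Require Import Defs.
From HB Require Import structures.
From mathcomp Require Import all_boot all_order all_algebra.
From mathcomp Require Import complex zify ring.
From mathcomp Require Import all_classical all_reals all_analysis.

Import Order.TTheory GRing.Theory Num.Theory.
Import numFieldNormedType.Exports.
Local Open Scope ring_scope.
Set Implicit Arguments.
Unset Strict Implicit.
Unset Printing Implicit Defensive.

(** The Laplacian is the Gram matrix of the rows of the signed incidence
    function.  Being of the form B B^T with B real, it has only real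
    nonnegative eigenvalues ([eigenvalue_mul_tr_ge0]), so the Gershgorin discs
    ([gershgorin]) become real intervals.  The diagonal entry at v is the degree
    of v, and the off-diagonal entries are the numbers of co-oriented minus
    anti-oriented hyperedges: this yields the vertex bounds
    ([laplacian_vertex_disc]).  A nonzero eigenvalue of B B^T is also an
    eigenvalue of B^T B, the Gram matrix of the columns, whose diagonal entries
    are the degrees of the hyperedges and whose off-diagonal entries are the
    signed overlaps: this yields the hyperedge bounds ([laplacian_edge_disc]).

    The second family of bounds is weaker than the first.  By the triangle
    inequality, a row sum of absolute values of a Gram matrix, diagonal
    included, is at most a double sum of absolute incidences ([gram_row_le]),
    and that double sum counts degrees ([vdeg_orient_le], [edeg_overlap_le]).

    When every diagonal entry strictly dominates its row, no disc contains 0 and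
    all eigenvalues are positive.  The spectral theorem then writes the entries
    of the powers of the Laplacian as fixed combinations of the powers of
    finitely many positive reals ([positive_symmetric_powers]).  Summing the
    exponential series entrywise gives the same combinations of decaying
    exponentials, and hence an exponential bound on the operator norm
    ([expmx_decay]). *)

(** * Euclidean operator norm and exponential of a real matrix *)

Lemma l2norm_le_sum (R : realType) (n : nat) (x : 'cV[R]_n) :
  l2norm x <= \sum_i `|x i 0|.
Proof.
have s0 : 0 <= \sum_i `|x i 0| by exact: sumr_ge0.
rewrite /l2norm -(ler_sqr (sqrtr_ge0 _)) ?nnegrE// sqr_sqrtr; last first.
  by apply: sumr_ge0 => i _; exact: sqr_ge0.
rewrite expr2 mulr_suml; apply: ler_sum => i _.
rewrite -real_normK ?num_real// expr2 ler_wpM2l// (bigD1 i)//= lerDl.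
exact: sumr_ge0.
Qed.

Lemma normr_le_l2norm (R : realType) (n : nat) (x : 'cV[R]_n) (j : 'I_n) :
  `|x j 0| <= l2norm x.
Proof.
rewrite -sqrtr_sqr ler_wsqrtr// (bigD1 j)//= lerDl.
by apply: sumr_ge0 => i _; exact: sqr_ge0.
Qed.

(** A crude bound is enough, as exponential stability leaves M free. *)
Lemma l2opnorm_le_sum (R : realType) (n : nat) (A : 'M[R]_n) :
  l2opnorm A <= \sum_i \sum_j `|A i j|.
Proof.
apply: ge_sup.
  exists (l2norm (A *m 0)); exists 0 => //=.
  apply: le_trans (l2norm_le_sum _) _; rewrite big1// => i _.
  by rewrite mxE normr0.
move=> _ [x /= x1 <-]; apply: le_trans (l2norm_le_sum _) _.
apply: ler_sum => i _; rewrite mxE.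
apply: le_trans (ler_norm_sum _ _ _) _; apply: ler_sum => j _.
by rewrite normrM ler_piMr// (le_trans (normr_le_l2norm _ _)).
Qed.

(** A neighbourhood of a matrix contains a product of neighbourhoods of its
    entries, and finitely many eventual properties hold together eventually. *)
Lemma cvg_mx_entries (R : realType) (n : nat) (S : nat -> 'M[R]_n)
    (L : 'M[R]_n) :
  (forall i j, (S N i j @[N --> \oo] --> L i j)%classic) ->
  (S N @[N --> \oo] --> L)%classic.
Proof.
move=> SL A [P LP PA].
have : \forall N \near \oo%classic, forall i j, P i j (S N i j).
  apply: filter_forall => i; apply: filter_forall => j.
  by apply: (SL i j); exact: LP.
by apply: filterS => N SP; apply: PA.
Qed.

Lemma cvg_sum_seq (R : realType) (I : finType) (f : I -> nat -> R)
    (l : I -> R) :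
  (forall i, (f i N @[N --> \oo] --> l i)%classic) ->
  (\sum_i f i N @[N --> \oo] --> \sum_i l i)%classic.
Proof.
move=> fl; rewrite -fct_sumE.
apply: (big_ind2 (fun g m => (g N @[N --> \oo] --> m)%classic)) => //.
  exact: cvg_cst.
by move=> x1 x2 y1 y2 h1 h2; exact: cvgD.
Qed.

(** Square matrices of size 0 form the zero ring, so the law for powers of
    scaled elements of a nontrivial algebra does not cover them. *)
Lemma scalemx_expr (R : comPzRingType) (n : nat) (A : 'M[R]_n) (t : R)
    (k : nat) :
  (t *: A) ^+ k = t ^+ k *: A ^+ k.
Proof.
elim: k => [|k IHk]; first by rewrite !expr0 scale1r.
by rewrite !exprS IHk -!mulmxE -scalemxAl -scalemxAr scalerA.
Qed.

(** If the entries of all powers of A are combinations of powers of the d l with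
    coefficients independent of the exponent, then summing the series turns
    each power into an exponential.  This avoids the product formula for matrix
    exponentials. *)
Lemma expmx_entries (R : realType) (n : nat) (A : 'M[R]_n)
    (c : 'I_n -> 'I_n -> 'I_n -> R) (d : 'I_n -> R) (t : R) :
  (forall k i j, (A ^+ k) i j = \sum_l c i j l * d l ^+ k) ->
  forall i j, expmx (t *: A) i j = \sum_l c i j l * expR (t * d l).
Proof.
move=> Ak i j.
suff -> : expmx (t *: A) = \matrix_(i, j) \sum_l c i j l * expR (t * d l).
  by rewrite mxE.
apply: cvg_lim; first exact: norm_hausdorff.
apply: cvg_mx_entries => {}i {}j; rewrite mxE.
have E N : (\sum_(0 <= k < N) (k`!%:R)^-1 *: (t *: A) ^+ k) i j
    = \sum_l c i j l * series (exp_coeff (t * d l)) N.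
  rewrite summxE /series /=.
  under [RHS]eq_bigr do rewrite mulr_sumr.
  rewrite [RHS]exchange_big /=; apply: eq_bigr => k _.
  rewrite !mxE scalemx_expr !mxE Ak !mulr_sumr; apply: eq_bigr => l _.
  rewrite exp_coeffE /= exprMn [RHS]mulrCA; congr (_ * _); exact: mulrCA.
rewrite (eq_cvg _ _ E).
pose f l N := c i j l * series (exp_coeff (t * d l)) N.
apply: (cvg_sum_seq (f := f)) => l.
apply: cvgMl_tmp; exact: is_cvg_series_exp_coeff.
Qed.

(** The rate is the least of the d l, capped at 1 so that it is defined when
    n = 0.  The constant is the sum of all the `|c i j l|, plus 1 because M must
    be at least 1. *)
Lemma expmx_decay (R : realType) (n : nat) (A : 'M[R]_n)
    (c : 'I_n -> 'I_n -> 'I_n -> R) (d : 'I_n -> R) :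
  (forall l, 0 < d l) ->
  (forall k i j, (A ^+ k) i j = \sum_l c i j l * d l ^+ k) ->
  exponentially_stable (fun t : R => expmx (- t *: A)).
Proof.
move=> d0 Ak.
pose S := \sum_i \sum_j \sum_l `|c i j l|.
have S0 : 0 <= S by do 3!(apply: sumr_ge0 => ? _).
exists (1 + S), (\big[Num.min/1]_l d l); split; first by rewrite lerDl.
  by apply: lt_bigmin.
move=> t t0; apply: le_trans (l2opnorm_le_sum _) _.
apply: (@le_trans _ _ (S * expR (- (\big[Num.min/1]_l d l) * t))); last first.
  by rewrite ler_wpM2r ?expR_ge0// lerDr.
rewrite mulr_suml; apply: ler_sum => i _.
rewrite mulr_suml; apply: ler_sum => j _.
rewrite (expmx_entries _ Ak)// mulr_suml.
apply: le_trans (ler_norm_sum _ _ _) _; apply: ler_sum => l _.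
rewrite normrM ler_wpM2l// ger0_norm ?expR_ge0// ler_expR !mulNr lerN2 mulrC.
by rewrite ler_wpM2l// bigmin_le.
Qed.

(** * Eigenvalues: Gershgorin discs, matrices B B^T, spectral decomposition *)

(** Let i be the index of an entry of largest modulus of an eigenvector v: the
    bound follows from the i-th coordinate of v A = a v, divided by v_i.
    Eigenvectors are row vectors, so the radius of the disc is a column sum. *)
Lemma gershgorin (C : numFieldType) (n : nat) (A : 'M[C]_n) (a : C) :
  eigenvalue A a ->
  exists i, `|a - A i i| <= \sum_(j | j != i) `|A j i|.
Proof.
case/eigenvalueP => v vA /rV0Pn[i0 vi0].
(* The order of C is partial, but the moduli are real, hence comparable. *)
case: (@real_arg_maxP C _ i0 xpredT (fun i => `|v 0 i|)) => //= i _ imax.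
have vi_gt0 : 0 < `|v 0 i|.
  by apply: lt_le_trans (imax i0 isT); rewrite normr_gt0.
exists i; rewrite -(ler_pM2r vi_gt0) -normrM mulr_suml.
have -> : (a - A i i) * v 0 i = \sum_(j | j != i) v 0 j * A j i.
  have := congr1 (fun u : 'rV_n => u 0 i) vA; rewrite !mxE (bigD1 i)//= => E.
  by rewrite mulrBl -E [A i i * _]mulrC addrAC subrr add0r.
apply: le_trans (ler_norm_sum _ _ _) _; apply: ler_sum => j _.
by rewrite normrM mulrC ler_wpM2l// imax.
Qed.

(** If v B B^T = a v, then pairing with the conjugate of v gives
    a |v|^2 = |v B|^2, because B is real. *)
Lemma eigenvalue_mul_tr_ge0 (R : rcfType) (m n : nat) (B : 'M[R]_(m, n))
    (a : R[i]) :
  let BC := map_mx (real_complex R) B in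
  eigenvalue (BC *m BC^T) a -> 0 <= a.
Proof.
move=> BC /eigenvalueP[v vB v0].
pose sqn k (u : 'rV[R[i]]_k) := (u *m (map_mx Num.conj u)^T) 0 0.
have sqnE k (u : 'rV_k) : sqn k u = \sum_i `|u 0 i| ^+ 2.
  by rewrite /sqn mxE; apply: eq_bigr => i _; rewrite !mxE normCK.
have BCr : map_mx Num.conj BC = BC.
  by apply/matrixP => i j; rewrite !mxE; apply/CrealP/complex_realP; eexists.
have E : a * sqn _ v = sqn _ (v *m BC).
  have := congr1 (fun u => (u *m (map_mx Num.conj v)^T) 0 0) vB.
  rewrite -[in RHS]scalemxAl [RHS]mxE => <-.
  by rewrite /sqn map_mxM/= BCr trmx_mul !mulmxA.
have v_gt0 : 0 < sqn _ v.
  have /rV0Pn[i vi] := v0.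
  rewrite sqnE (bigD1 i)//=; apply: ltr_pwDl.
    by rewrite exprn_gt0// normr_gt0.
  by apply: sumr_ge0 => j _; rewrite exprn_ge0.
rewrite -(pmulr_lge0 _ v_gt0) E sqnE.
by apply: sumr_ge0 => j _; rewrite exprn_ge0.
Qed.

(** If v is an eigenvector of A B, then v A is one of B A; it is nonzero because
    (v A) B = a v is. *)
Lemma eigenvalue_mulmxC (F : fieldType) (m n : nat) (A : 'M[F]_(m, n))
    (B : 'M[F]_(n, m)) (a : F) :
  a != 0 -> eigenvalue (A *m B) a -> eigenvalue (B *m A) a.
Proof.
move=> a0 /eigenvalueP[v vAB v0]; apply/eigenvalueP; exists (v *m A).
  by rewrite mulmxA -[v *m A *m B]mulmxA vAB scalemxAl.
apply: contra_neq v0 => vA.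
have /eqP := vAB; rewrite mulmxA vA mul0mx eq_sym scaler_eq0 (negPf a0)/=.
by move/eqP.
Qed.

Lemma ReM_real (R : rcfType) (x : R[i]) (y : R) :
  complex.Re (x * (y%:C)%C) = complex.Re x * y.
Proof. by case: x => u w /=; rewrite mulr0 subr0. Qed.

Lemma diagonalized_power (F : fieldType) (n : nat) (A P : 'M[F]_n)
    (d : 'rV[F]_n) (k : nat) :
  P \in unitmx -> A = invmx P *m diag_mx d *m P ->
  A ^+ k = invmx P *m diag_mx (\row_l d 0 l ^+ k) *m P.
Proof.
move=> P_unit AE; elim: k => [|k IHk].
  have -> : diag_mx (\row_l d 0 l ^+ 0) = 1%:M.
    by apply/matrixP => a b; rewrite !mxE expr0.
  by rewrite mulmx1 mulVmx.
have -> : A ^+ k.+1 = A ^+ k *m A by exact: exprSr.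
rewrite IHk [in LHS]AE !mulmxA mulmxK// -[_ *m _ *m diag_mx d]mulmxA mulmx_diag.
by congr (_ *m diag_mx _ *m _); apply/rowP => l; rewrite !mxE exprSr.
Qed.

(** The unitary P diagonalizing A is complex while A is real: since the
    eigenvalues are real, taking real parts of A^k = P^-1 D^k P affects only the
    coefficients. *)
Lemma positive_symmetric_powers (R : rcfType) (n : nat) (A : 'M[R]_n) :
  A^T = A ->
  (forall a : R[i], eigenvalue (map_mx (real_complex R) A) a -> 0 < a) ->
  exists (c : 'I_n -> 'I_n -> 'I_n -> R) (d : 'I_n -> R),
    (forall l, 0 < d l) /\
    forall k i j, (A ^+ k) i j = \sum_l c i j l * d l ^+ k.
Proof.
move=> A_sym A_pos; set AC := map_mx (real_complex R) A.
have AC_herm : AC \is hermsymmx.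
  apply: realsym_hermsym.
    apply/is_hermitianmxP; rewrite expr0 scale1r.
    by apply/matrixP => i j; rewrite !mxE -[in LHS]A_sym mxE.
  by apply/mxOverP => i j; rewrite mxE; apply/complex_realP; eexists.
have /orthomx_spectralP/= := hermitian_normalmx AC_herm.
set P := spectralmx AC; set D := spectral_diag AC => ACE.
have P_unit : P \in unitmx := spectral_unit AC.
have D_pos l : 0 < D 0 l.
  apply: A_pos; apply/eigenvalueP; exists (row l P).
    rewrite -/AC ACE !mulmxA -row_mul mulmxV// row1 -rowE row_diag_mx.
    by rewrite -scalemxAl -rowE.
  apply/eqP => /(congr1 (mulmxr (invmx P)))/=.
  rewrite mul0mx -row_mul mulmxV// row1 => /rowP/(_ l)/eqP.
  by rewrite !mxE !eqxx oner_eq0.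
exists (fun i j l => complex.Re (invmx P i l * P l j)).
exists (fun l => complex.Re (D 0 l)); split.
  by move=> l; have := D_pos l; rewrite ltcE => /andP[].
move=> k i j.
have DE l : D 0 l = ((complex.Re (D 0 l))%:C)%C.
  by rewrite RRe_real// gtr0_real.
have -> : (A ^+ k) i j = complex.Re ((AC ^+ k) i j).
  by rewrite -(rmorphXn (map_mx (real_complex R))) mxE.
rewrite (diagonalized_power k P_unit ACE) mul_mx_diag mxE.
rewrite (big_morph _ (raddfD (@complex.Re R)) (raddf0 (@complex.Re R))).
apply: eq_bigr => l _; rewrite !mxE [in LHS]DE -rmorphXn/= mulrAC ReM_real.
by [].
Qed.

(** * Gram matrices of integer families indexed by finite types *)

Definition intmx (K : pzRingType) (A B : finType) (M : A -> B -> int) :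
    'M[K]_(#|A|, #|B|) :=
  \matrix_(i, j) (M (enum_val i) (enum_val j))%:~R.

Definition gram (A B : finType) (M : A -> B -> int) (a a' : A) : int :=
  \sum_b M a b * M a' b.

Lemma gramC (A B : finType) (M : A -> B -> int) a a' :
  gram M a a' = gram M a' a.
Proof. by apply: eq_bigr => b _; rewrite mulrC. Qed.

Lemma tr_intmx (K : pzRingType) (A B : finType) (M : A -> B -> int) :
  (intmx K M)^T = intmx K (fun b a => M a b).
Proof. by apply/matrixP => i j; rewrite !mxE. Qed.

Lemma map_intmx (R : rcfType) (A B : finType) (M : A -> B -> int) :
  map_mx (real_complex R) (intmx R M) = intmx R[i] M.
Proof. by apply/matrixP => i j; rewrite !mxE rmorph_int. Qed.

Lemma intmx_mul_tr (K : comPzRingType) (A B : finType) (M : A -> B -> int) :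
  intmx K M *m (intmx K M)^T = intmx K (gram M).
Proof.
apply/matrixP => i j; rewrite !mxE /gram rmorph_sum/=.
rewrite (big_enum_val (A := B)) /=; apply: eq_bigr => k _.
by rewrite !mxE rmorphM.
Qed.

Lemma gershgorin_intmx (C : numFieldType) (A : finType) (g : A -> A -> int)
    (x : C) :
  eigenvalue (intmx C g) x ->
  exists a, `|x - (g a a)%:~R| <= (\sum_(b | b != a) absz (g b a))%N%:R.
Proof.
case/gershgorin => i; rewrite mxE => xi; exists (enum_val i).
apply: le_trans xi _; rewrite natr_sum.
rewrite [leRHS](big_enum_val_cond (A := A)) /=.
rewrite (eq_bigl (fun j => enum_val j != enum_val i)); last first.
  by move=> j; rewrite (inj_eq enum_val_inj).
by apply: ler_sum => j _; rewrite mxE natr_absz intr_norm.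
Qed.

Lemma absz_sum_le (I : finType) (f : I -> int) :
  (absz (\sum_i f i)%R <= \sum_i absz (f i))%N.
Proof.
elim/big_ind2 : _ => // m1 n1 m2 n2 h1 h2.
apply: leq_trans (leq_add h1 h2).
by rewrite -lez_nat PoszD !abszE ler_normD.
Qed.

(** The triangle inequality inside each entry of the Gram matrix, followed by an
    exchange of sums. *)
Lemma gram_row_le (A B : finType) (M : A -> B -> int) (a : A) :
  (absz (gram M a a) + \sum_(a' | a' != a) absz (gram M a' a) <=
   \sum_b absz (M a b) * \sum_a' absz (M a' b))%N.
Proof.
have -> : (absz (gram M a a) + \sum_(a' | a' != a) absz (gram M a' a) =
           \sum_a' absz (gram M a' a))%N by rewrite [RHS](bigD1 a).
under [leqRHS]eq_bigr do rewrite big_distrr/=.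
rewrite exchange_big/=; apply: leq_sum => a' _.
apply: leq_trans (absz_sum_le _) _; apply: leq_sum => b _.
by rewrite abszM mulnC.
Qed.

(** * Laplacian of a directed hypergraph *)

Section Hypergraph.
Variables (V E : finType) (H : dihypergraph V E).
Implicit Types (v w : V) (e f : E).

Lemma laplacian_gram (K : comPzRingType) :
  laplacian H K = intmx K (gram (iota_ve H)).
Proof. exact: intmx_mul_tr. Qed.

Lemma iota_veE v e :
  iota_ve H v e = (v \in targ H e)%:Z - (v \in sour H e)%:Z.
Proof.
rewrite /iota_ve; case: ifP => vt; last by case: ifP.
have := @sour_targ_disjoint V E H e; rewrite disjoint_sym.
by move=> /disjointFr/(_ vt) ->.
Qed.

Lemma absz_iota v e : absz (iota_ve H v e) = (v \in Defs.support H e) :> nat.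
Proof.
by rewrite /iota_ve inE; case: (v \in targ H e); case: (v \in sour H e).
Qed.

Lemma in_edges_at v e : (e \in edges_at H v) = (v \in Defs.support H e).
Proof. by rewrite [LHS]inE. Qed.

Lemma sum_absz_iota e : (\sum_v absz (iota_ve H v e) = edeg H e)%N.
Proof.
under eq_bigr do rewrite absz_iota.
rewrite -big_mkcond sum1_card /edeg /Defs.support cardsU.
have /disjoint_setI0 -> := @sour_targ_disjoint V E H e.
by rewrite cards0 subn0.
Qed.

Lemma gram_iota v w :
  gram (iota_ve H) v w = #|co_edges H v w|%:Z - #|anti_edges H v w|%:Z.
Proof.
have cardE (P : pred E) : #|[set e | P e]|%:Z = \sum_e (P e)%:Z.
  rewrite cardsE -sum1_card big_mkcond/= -natz natr_sum.
  by apply: eq_bigr => e _; rewrite unfold_in; case: (P e).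
rewrite !cardE -sumrB; apply: eq_bigr => e _.
by rewrite /iota_ve; do !case: ifP => _.
Qed.

Lemma gram_iota_diag v : gram (iota_ve H) v v = vdeg H v.
Proof.
rewrite /vdeg -sum1_card -natz natr_sum [RHS]big_mkcond.
apply: eq_bigr => e _.
by rewrite !inE /iota_ve; case: (v \in targ H e); case: (v \in sour H e).
Qed.

Lemma gram_iota_edges e f :
  gram (fun e v => iota_ve H v e) e f =
  #|targ H e :&: targ H f|%:Z + #|sour H e :&: sour H f|%:Z
  - #|targ H e :&: sour H f|%:Z - #|sour H e :&: targ H f|%:Z.
Proof.
have cardIE (A B : {set V}) :
    #|A :&: B|%:Z = \sum_v (v \in A)%:Z * (v \in B)%:Z.
  rewrite -sum1_card big_mkcond/= -natz natr_sum; apply: eq_bigr => v _.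
  by rewrite inE; case: (v \in A); case: (v \in B).
rewrite !cardIE -!sumrN -!big_split/=; apply: eq_bigr => v _.
rewrite !iota_veE; ring.
Qed.

Lemma gram_iota_edges_diag e : gram (fun e v => iota_ve H v e) e e = edeg H e.
Proof.
rewrite -sum_absz_iota -natz natr_sum.
apply: eq_bigr => v _.
by rewrite /iota_ve; case: (v \in targ H e); case: (v \in sour H e).
Qed.

Lemma orient_sumE v :
  orient_sum H v = (\sum_(w | w != v) absz (gram (iota_ve H) w v))%N.
Proof. by apply: eq_bigr => w _; rewrite gramC gram_iota. Qed.

Lemma overlap_sumE e :
  overlap_sum H e =
  (\sum_(f | f != e) absz (gram (fun e v => iota_ve H v e) f e))%N.
Proof. by apply: eq_bigr => f _; rewrite gramC gram_iota_edges. Qed.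

(** In the row estimate for the Gram matrix of the rows, the diagonal term is
    the degree of v, and the double sum counts the vertices of the hyperedges
    through v. *)
Lemma vdeg_orient_le v : (vdeg H v + orient_sum H v <= edeg_sum H v)%N.
Proof.
have := gram_row_le (iota_ve H) v.
rewrite gram_iota_diag -orient_sumE absz_nat => /leq_trans; apply.
rewrite /edeg_sum [leqRHS]big_mkcond; apply: leq_sum => e _.
by rewrite sum_absz_iota absz_iota in_edges_at; case: (v \in _); rewrite ?mul1n.
Qed.

Lemma sum_absz_iota_edges v : (\sum_e absz (iota_ve H v e) = vdeg H v)%N.
Proof.
rewrite /vdeg -sum1_card [RHS]big_mkcond; apply: eq_bigr => e _.
by rewrite absz_iota in_edges_at; case: (v \in _).
Qed.

(** The dual of [vdeg_orient_le], for the Gram matrix of the columns. *)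
Lemma edeg_overlap_le e : (edeg H e + overlap_sum H e <= vdeg_sum H e)%N.
Proof.
have := gram_row_le (fun e v => iota_ve H v e) e.
rewrite gram_iota_edges_diag -overlap_sumE absz_nat => /leq_trans; apply.
rewrite /vdeg_sum [leqRHS]big_mkcond; apply: leq_sum => v _.
by rewrite sum_absz_iota_edges absz_iota; case: ifP; rewrite ?mul1n.
Qed.

(** The value #|E| of an empty minimum is not a neutral element of minn, so v
    is located by induction on the enumeration instead of being split off. *)
Lemma vdeg_min_le v : (vdeg_min H <= vdeg H v)%N.
Proof.
rewrite /vdeg_min; elim: (index_enum V) (mem_index_enum v) => // w s IHs.
rewrite inE big_cons geq_min => /orP[/eqP <-|/IHs ->]; first by rewrite leqnn.
by rewrite orbT.
Qed.

Variable R : realType.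
Implicit Type lambda : R[i].

Lemma laplacian_eigenvalue_ge0 lambda :
  eigenvalue (laplacian H R[i]) lambda -> 0 <= lambda.
Proof.
rewrite /laplacian -[incidence H _]/(intmx R[i] (iota_ve H)) -map_intmx.
exact: eigenvalue_mul_tr_ge0.
Qed.

Lemma nonneg_disc (lambda : R[i]) (d r : nat) : 0 <= lambda ->
  `|lambda - (d%:Z)%:~R| <= r%:R -> d%:R - r%:R <= lambda <= d%:R + r%:R.
Proof.
by move=> l0; rewrite -pmulrn real_ler_distl// rpredB ?realn// ger0_real.
Qed.

Lemma laplacian_vertex_disc lambda :
  eigenvalue (laplacian H R[i]) lambda ->
  exists v, (vdeg H v)%:R - (orient_sum H v)%:R <= lambda
            <= (vdeg H v)%:R + (orient_sum H v)%:R.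
Proof.
move=> eig; have l0 := laplacian_eigenvalue_ge0 eig.
move: eig; rewrite laplacian_gram => /gershgorin_intmx[v].
by rewrite gram_iota_diag -orient_sumE => /(nonneg_disc l0); exists v.
Qed.

(** A nonzero eigenvalue passes from B B^T to B^T B, whereas 0 can be an
    eigenvalue of B B^T only: this can happen when there are more vertices than
    hyperedges. *)
Lemma laplacian_edge_disc lambda : lambda != 0 ->
  eigenvalue (laplacian H R[i]) lambda ->
  exists e, lambda <= (edeg H e)%:R + (overlap_sum H e)%:R.
Proof.
move=> l_neq0 eig; have l0 := laplacian_eigenvalue_ge0 eig.
move: eig => /(eigenvalue_mulmxC l_neq0).
rewrite -[incidence H _]/(intmx R[i] (iota_ve H)) tr_intmx.
rewrite -[X in _ *m X]trmxK tr_intmx intmx_mul_tr => /gershgorin_intmx[e].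
rewrite gram_iota_edges_diag -overlap_sumE => /(nonneg_disc l0)/andP[_ le].
by exists e.
Qed.

(** Strict diagonal dominance keeps 0 out of every disc, and the eigenvalues,
    already nonnegative, are then positive. *)
Lemma laplacian_stable :
  (forall v, (orient_sum H v < vdeg H v)%N) ->
  ~~ eigenvalue (laplacian H R[i]) 0
  /\ exponentially_stable (fun t : R => expmx (- t *: laplacian H R)).
Proof.
move=> dominant.
have not_eig0 : ~~ eigenvalue (laplacian H R[i]) 0.
  apply/negP => /laplacian_vertex_disc[v /andP[+ _]].
  by rewrite subr_le0 ler_nat leqNgt dominant.
split=> //.
have [||c [d [d_gt0 Lk]]] := @positive_symmetric_powers R _ (laplacian H R).
- by rewrite /laplacian trmx_mul trmxK.
- move=> a; rewrite laplacian_gram map_intmx -laplacian_gram => eig.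
  rewrite lt_neqAle laplacian_eigenvalue_ge0// andbT eq_sym.
  by apply: contraNneq not_eig0 => <-.
exact: expmx_decay d_gt0 Lk.
Qed.

End Hypergraph.

(* Eigenvalues are taken in the complex numbers R[i], where x <= y means that
   y - x is real and nonnegative; so the bounds also assert that lambda is
   real. *)
Theorem proposition3p2 (R : realType) (V E : finType) (H : dihypergraph V E)
    (V_nonempty : (0 < #|V|)%N) (E_nonempty : (0 < #|E|)%N) :
  ((forall lambda : R[i], eigenvalue (laplacian H R[i]) lambda ->
      [/\ (vdeg_min H)%:R - (\max_(v : V) orient_sum H v)%N%:R <= lambda,
          lambda <= (vdeg_max H)%:R + (\max_(v : V) orient_sum H v)%N%:R
        & lambda <= (edeg_max H)%:R + (\max_(e : E) overlap_sum H e)%N%:R])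
   /\
   ((forall v : V, (orient_sum H v < vdeg H v)%N) ->
      ~~ eigenvalue (laplacian H R[i]) 0
      /\ exponentially_stable (fun t : R => expmx (- t *: laplacian H R))))
  /\
  ((forall lambda : R[i], eigenvalue (laplacian H R[i]) lambda ->
      [/\ 2 * (vdeg_min H)%:R - (\max_(v : V) edeg_sum H v)%N%:R <= lambda,
          lambda <= (\max_(v : V) edeg_sum H v)%N%:R
        & lambda <= (\max_(e : E) vdeg_sum H e)%N%:R])
   /\
   ((forall v : V, (edeg_sum H v < 2 * vdeg H v)%N) ->
      ~~ eigenvalue (laplacian H R[i]) 0
      /\ exponentially_stable (fun t : R => expmx (- t *: laplacian H R)))).
Proof.
pose D := (\max_(v : V) edeg_sum H v)%N.
have D_max v : (edeg_sum H v <= D)%N := leq_bigmax v.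
split; split.
- move=> lambda eig; have l0 := laplacian_eigenvalue_ge0 eig.
  have [v /andP[lo hi]] := laplacian_vertex_disc eig; split.
  + by apply: le_trans lo; rewrite lerB ?ler_nat ?vdeg_min_le ?leq_bigmax.
  + by apply: le_trans hi _; rewrite lerD// ler_nat// leq_bigmax.
  (* For lambda = 0 the hyperedge bound only says that its right side is
     nonnegative. *)
  have [->|l_neq0] := eqVneq lambda 0; first by rewrite addr_ge0.
  have [e he] := laplacian_edge_disc l_neq0 eig.
  by apply: le_trans he _; rewrite lerD// ler_nat leq_bigmax.
- exact: laplacian_stable.
- move=> lambda eig; have l0 := laplacian_eigenvalue_ge0 eig.
  have [v /andP[lo hi]] := laplacian_vertex_disc eig; split.
  + apply: le_trans lo; rewrite lerBlDr addrAC lerBrDr -natrM -!natrD ler_nat.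
    have := vdeg_orient_le H v; have := vdeg_min_le H v.
    by have := D_max v; lia.
  + apply: le_trans hi _; rewrite -natrD ler_nat.
    exact: leq_trans (vdeg_orient_le H v) (D_max v).
  have [->|l_neq0] := eqVneq lambda 0; first by [].
  have [e he] := laplacian_edge_disc l_neq0 eig.
  apply: le_trans he _; rewrite -natrD ler_nat.
  exact: leq_trans (edeg_overlap_le H e) (leq_bigmax e).
- move=> dominant; apply: laplacian_stable => v.
  by have := vdeg_orient_le H v; have := dominant v; lia.
Qed.
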